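(* Consider the 1D bound-preserving (BP) active flux method described in the context: the limited forward-Euler step $\mathcal S$ (limited cell-average update and limited point-value update), advanced in time by the SSP-RK3 scheme. Suppose the initial degrees of freedom satisfy $\overline{\mathbf U}^0_i\in\mathcal G$ and $\mathbf U^0_{i+1/2}\in\mathcal G$ for all $i$, and that the time step size satisfies (at every forward-Euler stage, for all $i$) $$\Delta t^n\le\frac{\Delta x_i}{\alpha_{i-1/2}+\alpha_{i+1/2}}\qquad\text{and}\qquad \Delta t^n\le\frac{\Delta x_i+\Delta x_{i+1}}{2(\alpha_i+\alpha_{i+1})}.$$ Then: (a) (Scalar case.) For the scalar conservation law, the method with the scalar cell-average limiting and the scalar point-value limiting of the context preserves the maximum principle: at every later time level $n$, $m_0\le\bar u^n_i\le M_0$ and $m_0\le u^n_{i+1/2}\le M_0$ for all $i$. (b) (Euler case.) For the compressible Euler equations, the method with the Euler cell-average limiting and the Euler point-value limiting of the context preserves positive density and pressure: at every later time level $n$, all cell averages $\overline{\mathbf U}^n_i$ and point values $\mathbf U^n_{i+1/2}$ have positive density and positive pressure.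
   Context: **Equations.** $\mathbf U_t+\mathbf F(\mathbf U)_x=0$, $\mathbf U(x,0)=\mathbf U_0(x)$. Two cases: - Scalar: $u_t+f(u)_x=0$, $u(\cdot,0)=u_0$, with $\mathcal G=\{u:m_0\le u\le M_0\}$, $m_0=\min u_0$, $M_0=\max u_0$. - Euler: $\mathbf U=(\rho,\rho v,E)^\top$, $\mathbf F=(\rho v,\rho v^2+p,(E+p)v)^\top$, $p=(\gamma-1)(E-(\rho v)^2/(2\rho))$, $\gamma>1$, with $\mathcal G=\{\mathbf U:\rho>0,\ p>0\}$. $\varrho(\mathbf U)$ is the spectral radius of $\partial\mathbf F/\partial\mathbf U$. The local Lax-Friedrichs (LLF) flux is $\widehat{\mathbf F}^{LLF}(\mathbf V,\mathbf W)=\frac12(\mathbf F(\mathbf V)+\mathbf F(\mathbf W))-\frac{\alpha}{2}(\mathbf W-\mathbf V)$ with $\alpha=\max\{\varrho(\mathbf V),\varrho(\mathbf W)\}$. All such viscosity coefficients that occur are assumed positive. **Mesh and degrees of freedom (DoFs).** Cells $I_i=[x_{i-1/2},x_{i+1/2}]$, $i=1,\dots,N$, of size $\Delta x_i$. DoFs: cell averages $\overline{\mathbf U}_i$ and interface point values $\mathbf U_{i+1/2}$. Values outside the mesh come from ghost cells according to the boundary conditions (e.g. periodic), belong to $\mathcal G$, and are included among ''all DoFs''. **Semi-discrete active flux method.** $$\frac{d\overline{\mathbf U}_i}{dt}=-\frac1{\Delta x_i}[\mathbf F(\mathbf U_{i+1/2})-\mathbf F(\mathbf U_{i-1/2})],\qquad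 \frac{d\mathbf U_{i+1/2}}{dt}=-\mathcal R_{i+1/2},$$ where $\mathcal R_{i+1/2}$ is a consistent approximation of $\partial_x\mathbf F$ at $x_{i+1/2}$, a given function of cell averages and point values in a stencil around $x_{i+1/2}$, well defined for DoFs in $\mathcal G$. **Limited forward-Euler step $\mathcal S$** (step size $\Delta t^n$, input DoFs with superscript $n$). *Low-order quantities.* $\alpha_{i+1/2}=\max\{\varrho(\overline{\mathbf U}^n_i),\varrho(\overline{\mathbf U}^n_{i+1})\}$, $\widehat{\mathbf F}^L_{i+1/2}=\widehat{\mathbf F}^{LLF}(\overline{\mathbf U}^n_i,\overline{\mathbf U}^n_{i+1})$, $$\widetilde{\mathbf U}_{i+1/2}=\tfrac12(\overline{\mathbf U}^n_i+\overline{\mathbf U}^n_{i+1})+\frac1{2\alpha_{i+1/2}}[\mathbf F(\overline{\mathbf U}^n_i)-\mathbf F(\overline{\mathbf U}^n_{i+1})],$$ $\widehat{\mathbf F}^H_{i+1/2}=\mathbf F(\mathbf U^n_{i+1/2})$, $\Delta\widehat{\mathbf F}_{i+1/2}=\widehat{\mathbf F}^H_{i+1/2}-\widehat{\mathbf F}^L_{i+1/2}$. *Cell average:* $\overline{\mathbf U}^{new}_i=\overline{\mathbf U}^n_i-\frac{\Delta t^n}{\Delta x_i}(\widehat{\mathbf F}^{Lim}_{i+1/2}-\widehat{\mathbf F}^{Lim}_{i-1/2})$, with limited fluxes: - Scalar cell-average limiting: $\hat f^{Lim}_{i+1/2}=\hat f^L_{i+1/2}+\Delta\hat f^{Lim}_{i+1/2}$.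 If $\Delta\hat f_{i+1/2}\ge0$, $$\Delta\hat f^{Lim}_{i+1/2}=\min\{\Delta\hat f_{i+1/2},\alpha_{i+1/2}(\tilde u_{i+1/2}-u^{\min}_i),\alpha_{i+1/2}(u^{\max}_{i+1}-\tilde u_{i+1/2})\},$$ otherwise $$\Delta\hat f^{Lim}_{i+1/2}=\max\{\Delta\hat f_{i+1/2},\alpha_{i+1/2}(u^{\min}_{i+1}-\tilde u_{i+1/2}),\alpha_{i+1/2}(\tilde u_{i+1/2}-u^{\max}_i)\}.$$ Here $u^{\min}_i=\min\mathcal N$, $u^{\max}_i=\max\mathcal N$, with $\mathcal N$ either the set of all DoFs at level $n$ (global), or $\{\bar u^n_i,\tilde u_{i-1/2},\tilde u_{i+1/2},\bar u^n_{i-1},\bar u^n_{i+1}\}$ (local). - Euler cell-average limiting. Superscripts $\rho,\rho v,E$ denote components. Let $\varepsilon^\rho,\varepsilon^p$ be the minimum density and pressure over all DoFs at level $n$; $\varepsilon^\rho_i=\min\{10^{-13},\varepsilon^\rho,\widetilde{\mathbf U}^\rho_{i-1/2},\widetilde{\mathbf U}^\rho_{i+1/2}\}$; $\varepsilon^p_i=\min\{10^{-13},\varepsilon^p,p(\widetilde{\mathbf U}_{i-1/2}),p(\widetilde{\mathbf U}_{i+1/2})\}$; $\bar\varepsilon^\rho=\min\{\varepsilon^\rho_i,\varepsilon^\rho_{i+1}\}$, $\bar\varepsilon^p=\min\{\varepsilon^p_i,\varepsilon^p_{i+1}\}$. Dropping the index $i+\frac12$: 1. $\Delta\widehat{\mathbf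 F}^{Lim,\rho}=\min\{\Delta\widehat{\mathbf F}^\rho,\alpha(\widetilde{\mathbf U}^\rho-\bar\varepsilon^\rho)\}$ if $\Delta\widehat{\mathbf F}^\rho\ge0$, else $\max\{\Delta\widehat{\mathbf F}^\rho,\alpha(\bar\varepsilon^\rho-\widetilde{\mathbf U}^\rho)\}$. Let $\widehat{\mathbf F}^*$ have density component $\widehat{\mathbf F}^{L,\rho}+\Delta\widehat{\mathbf F}^{Lim,\rho}$ and other components those of $\widehat{\mathbf F}^H$. Put $\mathbf D=\widehat{\mathbf F}^*-\widehat{\mathbf F}^L$. 2. With $\tilde\varepsilon=\bar\varepsilon^p/(\gamma-1)$ put $A=\frac12(\mathbf D^{\rho v})^2-\mathbf D^\rho\mathbf D^E$, $B=\alpha(\mathbf D^\rho\widetilde{\mathbf U}^E+\widetilde{\mathbf U}^\rho\mathbf D^E-\mathbf D^{\rho v}\widetilde{\mathbf U}^{\rho v}-\tilde\varepsilon\mathbf D^\rho)$, $C=\alpha^2(\widetilde{\mathbf U}^\rho\widetilde{\mathbf U}^E-\frac12(\widetilde{\mathbf U}^{\rho v})^2-\tilde\varepsilon\widetilde{\mathbf U}^\rho)$, $\theta=\min\{1,C/(\max\{0,A\}+|B|)\}$ ($\theta=1$ if the denominator is $0$). The limited flux is $\widehat{\mathbf F}^{Lim}=\widehat{\mathbf F}^L+\theta\mathbf D$. *Point values.* $\mathbf U^H_{i+1/2}=\mathbf U^n_{i+1/2}-\Delta t^n\mathcal R_{i+1/2}$, $\alpha_i=\max\{\varrho(\mathbf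 U^n_{i-1/2}),\varrho(\mathbf U^n_{i+1/2})\}$, and $$\mathbf U^L_{i+1/2}=\mathbf U^n_{i+1/2}-\frac{2\Delta t^n}{\Delta x_i+\Delta x_{i+1}}\left[\widehat{\mathbf F}^{LLF}(\mathbf U^n_{i+1/2},\mathbf U^n_{i+3/2})-\widehat{\mathbf F}^{LLF}(\mathbf U^n_{i-1/2},\mathbf U^n_{i+1/2})\right].$$ Below the index $i+\frac12$ is dropped. - Scalar point-value limiting: $u^{new}=\theta u^H+(1-\theta)u^L$, $\theta=\min\left\{1,\left|\frac{u^L-u^{\min}}{u^L-u^H}\right|,\left|\frac{u^{\max}-u^L}{u^H-u^L}\right|\right\}$ ($\theta=1$ if $u^H=u^L$), with $u^{\min}=\min\mathcal N$, $u^{\max}=\max\mathcal N$, $\mathcal N$ being the set of all DoFs at level $n$ (global) or $\{u^n_{i-1/2},u^n_{i+1/2},u^n_{i+3/2}\}$ (local). - Euler point-value limiting: $\varepsilon^\rho_{pt}=\min\{10^{-13},\varepsilon^\rho,\mathbf U^{L,\rho}\}$, $\varepsilon^p_{pt}=\min\{10^{-13},\varepsilon^p,p(\mathbf U^L)\}$. Put $\theta^*=\frac{\mathbf U^{L,\rho}-\varepsilon^\rho_{pt}}{\mathbf U^{L,\rho}-\mathbf U^{H,\rho}}$ if $\mathbf U^{H,\rho}<\varepsilon^\rho_{pt}$, else $1$. Let $\mathbf U^*$ have density $\theta^*\mathbf U^{H,\rho}+(1-\theta^* )\mathbf U^{L,\rho}$ and other components those of $\mathbf U^H$. Put $\theta^{**}=\frac{p(\mathbf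 U^L)-\varepsilon^p_{pt}}{p(\mathbf U^L)-p(\mathbf U^* )}$ if $p(\mathbf U^* )<\varepsilon^p_{pt}$, else $1$. Then $\mathbf U^{new}=\theta^{**}\mathbf U^*+(1-\theta^{**})\mathbf U^L$. **SSP-RK3.** With $\mathbf U$ the vector of all DoFs: $\mathbf U^*=\mathcal S(\mathbf U^n)$, $\mathbf U^{**}=\frac34\mathbf U^n+\frac14\mathcal S(\mathbf U^* )$, $\mathbf U^{n+1}=\frac13\mathbf U^n+\frac23\mathcal S(\mathbf U^{**})$, with the same $\Delta t^n$ in each stage. In the time step constraints, the coefficients $\alpha_{i+1/2}$ and $\alpha_i$ are those computed from the input DoFs of the stage.
   Formalization: In the scalar case it is additionally assumed that each viscosity coefficient max{|f'(v)|,|f'(w)|} that occurs bounds |f'(u)| for all u between v and w (true for convex or concave f); without this the maximum principle can fail, e.g. for f(u)=3u^2-2u^3+εu with data 0 and 1. *)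

(* Defs.v *)
From HB Require Import structures.
From mathcomp Require Import all_boot all_order all_algebra.
From mathcomp Require Import all_classical all_reals all_analysis.
From mathcomp.real_closed Require Import complex.

Set Implicit Arguments.
Unset Strict Implicit.
Unset Printing Implicit Defensive.

Import Order.TTheory GRing.Theory Num.Theory.
Import numFieldNormedType.Exports.

Local Open Scope classical_set_scope.
Local Open Scope ring_scope.

(* Degrees of freedom, indexed by all integers: [avg U i] is the average over
   the cell I_i and [pt U i] is the value at the interface x_(i+1/2).  With N
   cells, the mesh carries avg for 1 <= i <= N and pt for 0 <= i <= N; g layers
   of ghost cells extend this to 1-g <= i <= N+g and -g <= i <= N+g.  Entries
   beyond the ghost layers are meaningless. *)
Record dofs (V : Type) := Dofs { avg : int -> V; pt : int -> V }.

(* The limiting set: all degrees of freedom, or neighbouring values only. *)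
Inductive limiting_range := GlobalRange | LocalRange.

Section Mesh.
Variables (N g : nat) (V : Type).
Implicit Types (U W : dofs V) (G : set V).

Definition in_mesh G U : Prop :=
  (forall i : int, 1 <= i <= N%:Z -> G (avg U i)) /\
  (forall i : int, 0 <= i <= N%:Z -> G (pt U i)).

Definition ghosts_in G U : Prop :=
  (forall i : int, 1 - g%:Z <= i <= N%:Z + g%:Z -> ~~ (1 <= i <= N%:Z) ->
     G (avg U i)) /\
  (forall i : int, - g%:Z <= i <= N%:Z + g%:Z -> ~~ (0 <= i <= N%:Z) ->
     G (pt U i)).

(* A boundary condition is a map [b] that computes, from the degrees of freedom
   on the mesh, the values put in the ghost cells (copies of mesh values for
   periodic conditions, prescribed values for inflow, and so on). *)
Definition fill_ghosts (b : dofs V -> dofs V) U : dofs V :=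
  Dofs (fun i => if 1 <= i <= N%:Z then avg U i else avg (b U) i)
       (fun i => if 0 <= i <= N%:Z then pt U i else pt (b U) i).

Definition all_dofs U : seq V :=
  [seq avg U (1 - g%:Z + k%:Z) | k <- iota 0 (N + 2 * g)] ++
  [seq pt U (k%:Z - g%:Z) | k <- iota 0 (N + 2 * g).+1].

(* [Rop U i] depends only on the degrees of freedom in the g cells on either
   side of x_(i+1/2), including the interfaces of those cells. *)
Definition has_stencil (Rop : dofs V -> int -> V) : Prop :=
  forall U W (i : int),
    (forall j : int, i + 1 - g%:Z <= j <= i + g%:Z -> avg U j = avg W j) ->
    (forall j : int, i - g%:Z <= j <= i + g%:Z -> pt U j = pt W j) ->
    Rop U i = Rop W i.

(* [P v w] for every pair (v, w) of states whose LLF viscosity coefficient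
   occurs in the step.  The cell limiters of the first and last
   interface use Utilde one interface outside the mesh, whence -1 and N+1. *)
Definition viscosity_pairs (P : V -> V -> Prop) U : Prop :=
  (forall i : int, -1 <= i <= N%:Z + 1 -> P (avg U i) (avg U (i + 1))) /\
  (forall i : int, 0 <= i <= N%:Z + 1 -> P (pt U (i - 1)) (pt U i)).

End Mesh.

Section NonemptyMinMax.
Variable R : realType.

(* For nonempty s; the seed of the iteration is an element of s. *)
Definition min_seq (s : seq R) : R := \big[Num.min/head 0 s]_(y <- s) y.
Definition max_seq (s : seq R) : R := \big[Num.max/head 0 s]_(y <- s) y.

Definition is_minimum (A : set R) (m : R) : Prop := A m /\ lbound A m.
Definition is_maximum (A : set R) (m : R) : Prop := A m /\ ubound A m.

End NonemptyMinMax.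

Section System.
Variables (R : realType) (V : lmodType R).
(* [F] is the flux, [rho v] the spectral radius of its Jacobian at v, and
   [xh i] the interface x_(i+1/2). *)
Variables (F : V -> V) (rho : V -> R) (xh : int -> R).
Implicit Types (U : dofs V) (v w : V).

Definition dx (i : int) : R := xh i - xh (i - 1).

Definition llf_speed v w : R := Num.max (rho v) (rho w).

Definition llf v w : V :=
  2^-1 *: (F v + F w) - (llf_speed v w / 2) *: (w - v).

Definition intermediate v w : V :=
  2^-1 *: (v + w) + (2 * llf_speed v w)^-1 *: (F v - F w).

(* alpha_(i+1/2), from cell averages *)
Definition alpha_avg U (i : int) : R := llf_speed (avg U i) (avg U (i + 1)).
(* alpha_i, from point values *)
Definition alpha_pt U (i : int) : R := llf_speed (pt U (i - 1)) (pt U i).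

(* The quantities below carrying index i live at x_(i+1/2). *)
Definition flux_L U (i : int) : V := llf (avg U i) (avg U (i + 1)).
Definition flux_H U (i : int) : V := F (pt U i).
Definition Utilde U (i : int) : V := intermediate (avg U i) (avg U (i + 1)).

Definition avg_update (dt : R) U (flux : int -> V) (i : int) : V :=
  avg U i - (dt / dx i) *: (flux i - flux (i - 1)).

Definition pt_L (dt : R) U (i : int) : V :=
  pt U i - (2 * dt / (dx i + dx (i + 1))) *:
             (llf (pt U i) (pt U (i + 1)) - llf (pt U (i - 1)) (pt U i)).

Definition pt_H (Rop : dofs V -> int -> V) (dt : R) U (i : int) : V :=
  pt U i - dt *: Rop U i.

Definition cfl (N : nat) (dt : R) U : Prop :=
  (forall i : int, 1 <= i <= N%:Z ->
     dt <= dx i / (alpha_avg U (i - 1) + alpha_avg U i)) /\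
  (forall i : int, 0 <= i <= N%:Z ->
     dt <= (dx i + dx (i + 1)) / (2 * (alpha_pt U i + alpha_pt U (i + 1)))).

Definition viscosity_positive v w : Prop := 0 < llf_speed v w.

End System.

Section SSPRK3.
Variables (R : realType) (V : lmodType R) (N : nat).
(* [S dt] is the limited forward-Euler step, applied to data whose ghost values
   have been filled; [bc n k] is the boundary condition used in stage
   k (= 0, 1, 2) of the step from level n to level n+1. *)
Variables (S : R -> dofs V -> dofs V).
Variables (bc : nat -> nat -> dofs V -> dofs V).

Definition lincomb (a : R) (U : dofs V) (b : R) (W : dofs V) : dofs V :=
  Dofs (fun i => a *: avg U i + b *: avg W i)
       (fun i => a *: pt U i + b *: pt W i).

Definition stage0 (n : nat) (U : dofs V) : dofs V :=
  fill_ghosts N (bc n 0) U.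
Definition stage1 (n : nat) (dt : R) (U : dofs V) : dofs V :=
  fill_ghosts N (bc n 1) (S dt (stage0 n U)).
Definition stage2 (n : nat) (dt : R) (U : dofs V) : dofs V :=
  fill_ghosts N (bc n 2) (lincomb (3 / 4) U (1 / 4) (S dt (stage1 n dt U))).

Definition ssprk3 (n : nat) (dt : R) (U : dofs V) : dofs V :=
  lincomb (1 / 3) U (2 / 3) (S dt (stage2 n dt U)).

Fixpoint solution (dt : nat -> R) (U0 : dofs V) (n : nat) : dofs V :=
  if n is m.+1 then ssprk3 m (dt m) (solution dt U0 m) else U0.

(* [P dt W] at every forward-Euler stage, W being the stage input. *)
Definition every_stage (P : R -> dofs V -> Prop) (dt : nat -> R)
    (U0 : dofs V) : Prop :=
  forall n : nat,
    let U := solution dt U0 n in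
    [/\ P (dt n) (stage0 n U), P (dt n) (stage1 n (dt n) U)
      & P (dt n) (stage2 n (dt n) U)].

End SSPRK3.

Section Scalar.
Variables (R : realType) (N g : nat) (xh : int -> R) (f : R -> R).
Variables (Rop : dofs R^o -> int -> R^o).
Variables (range_avg range_pt : limiting_range).
Implicit Types U : dofs R^o.

Definition scalar_G (m0 M0 : R) : set R := [set u | m0 <= u <= M0].

Definition scalar_radius (u : R) : R := `|derive1 f u|.

Local Notation ut := (@Utilde R R^o f scalar_radius).
Local Notation fL := (@flux_L R R^o f scalar_radius).
Local Notation fH := (@flux_H R R^o f).
Local Notation alpha := (@alpha_avg R R^o scalar_radius).

(* The LLF coefficient bounds the wave speeds |f'(u)| for u between the two
   states.  For convex or concave f this always holds, f' being monotone; for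
   other f the larger speed of the end states may be too small, and Utilde may
   then leave the interval they span. *)
Definition speeds_bounded (v w : R) : Prop :=
  forall u : R, Num.min v w <= u <= Num.max v w ->
    scalar_radius u <= @llf_speed R R^o scalar_radius v w.

Definition avg_bound_set U (i : int) : seq R :=
  match range_avg with
  | GlobalRange => all_dofs N g U
  | LocalRange =>
      [:: avg U i; ut U (i - 1); ut U i; avg U (i - 1); avg U (i + 1)]
  end.

Definition umin U (i : int) : R := min_seq (avg_bound_set U i).
Definition umax U (i : int) : R := max_seq (avg_bound_set U i).

Definition scalar_dflux_lim U (i : int) : R :=
  let d : R := fH U i - fL U i in
  let a := alpha U i in
  if 0 <= d then
    Num.min d (Num.min (a * (ut U i - umin U i))
                       (a * (umax U (i + 1) - ut U i)))
  else
    Num.max d (Num.max (a * (umin U (i + 1) - ut U i))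
                       (a * (ut U i - umax U i))).

Definition scalar_flux_lim U (i : int) : R := fL U i + scalar_dflux_lim U i.

Definition pt_bound_set U (i : int) : seq R :=
  match range_pt with
  | GlobalRange => all_dofs N g U
  | LocalRange => [:: pt U (i - 1); pt U i; pt U (i + 1)]
  end.

Definition scalar_pt_new (dt : R) U (i : int) : R :=
  let uL : R := @pt_L R R^o f scalar_radius xh dt U i in
  let uH : R := @pt_H R R^o Rop dt U i in
  let lo := min_seq (pt_bound_set U i) in
  let hi := max_seq (pt_bound_set U i) in
  let theta := if uH == uL then 1 else
    Num.min 1 (Num.min `|(uL - lo) / (uL - uH)| `|(hi - uL) / (uH - uL)|) in
  theta * uH + (1 - theta) * uL.

Definition scalar_step (dt : R) U : dofs R^o :=
  Dofs (@avg_update R R^o xh dt U (scalar_flux_lim U)) (scalar_pt_new dt U).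

End Scalar.

(* Largest modulus of a complex eigenvalue. *)
Definition spectral_radius (R : realType) (n : nat) (A : 'M[R]_n) : R :=
  sup [set Normc.normc z | z in
         [set z : R[i] | eigenvalue (map_mx (real_complex R) A) z]].

Section Euler.
Variables (R : realType) (N g : nat) (xh : int -> R) (gamma : R).
Variables (Rop : dofs 'rV[R]_3 -> int -> 'rV[R]_3).
Implicit Types (U : dofs 'rV[R]_3) (u : 'rV[R]_3).

Definition mkstate (a b c : R) : 'rV[R]_3 := \row_(j < 3) [:: a; b; c]`_j.

(* Components of a state (rho, rho v, E), or of a flux. *)
Definition dens u : R := u 0 0.
Definition mom u : R := u 0 1.
Definition ener u : R := u 0 2.

Definition pressure u : R :=
  (gamma - 1) * (ener u - mom u ^+ 2 / (2 * dens u)).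

Definition euler_flux u : 'rV[R]_3 :=
  let v := mom u / dens u in
  mkstate (mom u) (dens u * v ^+ 2 + pressure u) ((ener u + pressure u) * v).

Definition euler_G : set 'rV[R]_3 := [set u | 0 < dens u /\ 0 < pressure u].

(* [jacobian] acts on row vectors, so it is the transpose of dF/dU; the
   spectrum is the same. *)
Definition euler_radius u : R := spectral_radius (jacobian euler_flux u).

Local Notation ut := (Utilde euler_flux euler_radius).
Local Notation FL := (flux_L euler_flux euler_radius).
Local Notation FH := (flux_H euler_flux).
Local Notation alpha := (alpha_avg euler_radius).

Definition eps_dens U : R := min_seq [seq dens u | u <- all_dofs N g U].
Definition eps_pres U : R := min_seq [seq pressure u | u <- all_dofs N g U].

Definition eps_dens_cell U (i : int) : R :=
  min_seq [:: 10 ^- 13; eps_dens U; dens (ut U (i - 1)); dens (ut U i)].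
Definition eps_pres_cell U (i : int) : R :=
  min_seq [:: 10 ^- 13; eps_pres U; pressure (ut U (i - 1)); pressure (ut U i)].

Definition eps_dens_bar U (i : int) : R :=
  Num.min (eps_dens_cell U i) (eps_dens_cell U (i + 1)).
Definition eps_pres_bar U (i : int) : R :=
  Num.min (eps_pres_cell U i) (eps_pres_cell U (i + 1)).

Definition dflux_lim_dens U (i : int) : R :=
  let d := dens (FH U i) - dens (FL U i) in
  let a := alpha U i in
  let e := eps_dens_bar U i in
  if 0 <= d then Num.min d (a * (dens (ut U i) - e))
  else Num.max d (a * (e - dens (ut U i))).

Definition flux_star U (i : int) : 'rV[R]_3 :=
  mkstate (dens (FL U i) + dflux_lim_dens U i) (mom (FH U i)) (ener (FH U i)).

Definition flux_theta U (i : int) : R :=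
  let D := flux_star U i - FL U i in
  let a := alpha U i in
  let T := ut U i in
  let e := eps_pres_bar U i / (gamma - 1) in
  let A := 2^-1 * mom D ^+ 2 - dens D * ener D in
  let B := a * (dens D * ener T + dens T * ener D - mom D * mom T
                - e * dens D) in
  let C := a ^+ 2 * (dens T * ener T - 2^-1 * mom T ^+ 2 - e * dens T) in
  let den := Num.max 0 A + `|B| in
  if den == 0 then 1 else Num.min 1 (C / den).

Definition euler_flux_lim U (i : int) : 'rV[R]_3 :=
  FL U i + flux_theta U i *: (flux_star U i - FL U i).

Definition euler_pt_new (dt : R) U (i : int) : 'rV[R]_3 :=
  let UL := pt_L euler_flux euler_radius xh dt U i in
  let UH := pt_H Rop dt U i in
  let er := min_seq [:: 10 ^- 13; eps_dens U; dens UL] in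
  let ep := min_seq [:: 10 ^- 13; eps_pres U; pressure UL] in
  let th1 := if dens UH < er then (dens UL - er) / (dens UL - dens UH)
             else 1 in
  let Us := mkstate (th1 * dens UH + (1 - th1) * dens UL) (mom UH) (ener UH) in
  let th2 := if pressure Us < ep
             then (pressure UL - ep) / (pressure UL - pressure Us)
             else 1 in
  th2 *: Us + (1 - th2) *: UL.

Definition euler_step (dt : R) U : dofs 'rV[R]_3 :=
  Dofs (avg_update xh dt U (euler_flux_lim U)) (euler_pt_new dt U).

End Euler.

(* Main.v *)
Require Import Defs.
From mathcomp Require Import all_boot all_order all_algebra.
From mathcomp Require Import all_classical all_reals all_analysis.
From mathcomp.real_closed Require Import complex.
From mathcomp Require Import ring lra zify.

(* G is convex, so it is enough to write every update as a convex combination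
   of states of G.  A local Lax-Friedrichs flux satisfies
   F(v) + alpha (v - I) = F^LLF(v, w) = F(w) - alpha (w - I), where
   I = (v + w) / 2 + (F(v) - F(w)) / (2 alpha) is the intermediate state; hence
   under the CFL condition a cell average is updated to a convex combination of
   itself and the intermediate states at the two interfaces, each shifted by
   the limited flux correction divided by -/+ alpha.  The same holds for the
   low-order point value, without a shift.
   The intermediate state is in G: for scalar laws because
   |f(v) - f(w)| <= alpha |v - w| by the mean value theorem, for the Euler
   equations because it is the midpoint of v + F(v) / alpha and
   w - F(w) / alpha, both in G as the spectral radius is at least |v| + c.
   The limiters keep the shifted states in G: for the Euler equations,
   rho (E - e) - (rho v)^2 / 2 is a quadratic C +/- B theta - A theta^2 in the
   blending coefficient theta, nonnegative for theta (max(0, A) + |B|) <= C. *)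

Set Implicit Arguments.
Unset Strict Implicit.
Unset Printing Implicit Defensive.

Import Order.TTheory GRing.Theory Num.Theory.
Import numFieldNormedType.Exports.

Local Open Scope classical_set_scope.
Local Open Scope ring_scope.

(** * Minima and maxima of nonempty sequences *)

Section MinMaxSeq.
Variable R : realType.
Implicit Types (s : seq R) (P : R -> Prop).

Lemma ge_min_seq s x : x \in s -> min_seq s <= x.
Proof. by move=> xs; exact: ge_bigmin_seq. Qed.

Lemma le_max_seq s x : x \in s -> x <= max_seq s.
Proof. by move=> xs; exact: le_bigmax_seq. Qed.

(** The seed is the head of [s] and a binary minimum returns one of its arguments, so the result is
    an element of [s]. *)
Lemma min_seq_ind P s : s != [::] -> (forall x, x \in s -> P x) -> P (min_seq s).
Proof.
move=> s0 Ps; rewrite /min_seq big_seq; apply: big_ind => //.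
  by apply: Ps; case: s s0 => // x s _; rewrite mem_head.
by move=> x y Px Py; rewrite minEle; case: ifP.
Qed.

Lemma max_seq_ind P s : s != [::] -> (forall x, x \in s -> P x) -> P (max_seq s).
Proof.
move=> s0 Ps; rewrite /max_seq big_seq; apply: big_ind => //.
  by apply: Ps; case: s s0 => // x s _; rewrite mem_head.
by move=> x y Px Py; rewrite maxEle; case: ifP.
Qed.

Lemma min_seq_gt0 s :
  s != [::] -> (forall x, x \in s -> 0 < x) -> 0 < min_seq s.
Proof. exact: (@min_seq_ind (fun x => 0 < x)). Qed.

End MinMaxSeq.

(** * Degrees of freedom on the mesh and in the ghost cells *)

Section DofsIn.
Variables (N g : nat).

(** What a forward-Euler step needs of its input; the step itself only gives back [in_mesh], and
    filling the ghost cells restores the rest. *)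
Definition dofs_in {V : Type} (G : set V) (U : dofs V) : Prop :=
  (forall i : int, 1 - g%:Z <= i <= N%:Z + g%:Z -> G (avg U i)) /\
  (forall i : int, - g%:Z <= i <= N%:Z + g%:Z -> G (pt U i)).

Lemma fill_ghosts_in {V : Type} (G : set V) b (W : dofs V) :
  in_mesh N G W -> ghosts_in N g G (b W) -> dofs_in G (fill_ghosts N b W).
Proof.
move=> [Wa Wp] [ba bp]; split=> i ig /=; case: ifP => [|/negbT] im.
- exact: Wa.
- exact: ba.
- exact: Wp.
- exact: bp.
Qed.

Lemma avg_in_all_dofs {V : eqType} (U : dofs V) (i : int) :
  1 - g%:Z <= i <= N%:Z + g%:Z -> avg U i \in all_dofs N g U.
Proof.
move=> ig; rewrite mem_cat; apply/orP; left; apply/mapP.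
exists (absz (i - 1 + g%:Z)); first by rewrite mem_iota; lia.
by congr (avg U _); lia.
Qed.

Lemma pt_in_all_dofs {V : eqType} (U : dofs V) (i : int) :
  - g%:Z <= i <= N%:Z + g%:Z -> pt U i \in all_dofs N g U.
Proof.
move=> ig; rewrite mem_cat; apply/orP; right; apply/mapP.
exists (absz (i + g%:Z)); first by rewrite mem_iota; lia.
by congr (pt U _); lia.
Qed.

Lemma all_dofs_in {V : eqType} (G : set V) (U : dofs V) :
  dofs_in G U -> forall v, v \in all_dofs N g U -> G v.
Proof.
move=> [Ua Up] v; rewrite mem_cat => /orP[] /mapP[k]; rewrite mem_iota => kN ->.
  by apply: Ua; lia.
by apply: Up; lia.
Qed.

Lemma all_dofs_neq0 {V : eqType} (U : dofs V) : all_dofs N g U != [::].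
Proof. by rewrite -size_eq0 size_cat !size_map !size_iota addnS. Qed.

End DofsIn.

(** * Convex combinations of states *)

Section Convexity.
Variables (R : realType) (V : lmodType R).

Definition is_convex (G : set V) : Prop :=
  forall u v (t : R), 0 <= t <= 1 -> G u -> G v -> G (t *: u + (1 - t) *: v).

Lemma convex_lincomb (G : set V) u v (a b : R) : is_convex G ->
  0 <= a -> 0 <= b -> a + b = 1 -> G u -> G v -> G (a *: u + b *: v).
Proof.
move=> cG a0 b0 ab Gu Gv; have -> : b = 1 - a by lra.
by apply: cG => //; lra.
Qed.

Lemma convex_lincomb3 (G : set V) u v w (a b c : R) : is_convex G ->
  0 <= a -> 0 <= b -> 0 <= c -> a + b + c = 1 -> G u -> G v -> G w ->
  G (a *: u + (b *: v + c *: w)).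
Proof.
move=> cG a0 b0 c0 abc Gu Gv Gw.
(* The last two weights are normalised by [b + c], which is impossible only when both vanish. *)
have [bc0|bc0] := eqVneq (b + c) 0.
  have -> : b = 0 by lra.
  have -> : c = 0 by lra.
  have -> : a = 1 by lra.
  by rewrite !scale0r !addr0 scale1r.
have bcp : 0 < b + c by rewrite lt_def bc0; lra.
have -> : b *: v + c *: w
    = (b + c) *: ((b / (b + c)) *: v + (c / (b + c)) *: w).
  by rewrite scalerDr !scalerA ![(b + c) * _]mulrC !divfK.
apply: convex_lincomb => //; [lra|lra|].
have bc_ge0 := ltW bcp.
by apply: convex_lincomb => //; [exact: divr_ge0|exact: divr_ge0|field].
Qed.

(** With [l] the ratio of time step to cell size and [p] the flux of [u] itself, [p] cancels in the
    difference and [u], [x], [y] get the weights 1 - l (a + b), l a, l b. *)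
Lemma convex_flux_update (G : set V) p u x y (l a b : R) : is_convex G ->
  0 <= l -> 0 <= a -> 0 <= b -> l * (a + b) <= 1 -> G u -> G x -> G y ->
  G (u - l *: ((p + a *: (u - x)) - (p - b *: (u - y)))).
Proof.
move=> cG l0 a0 b0 lab Gu Gx Gy.
rewrite [p + _]addrC addrKA opprK.
have -> : u - l *: (a *: (u - x) + b *: (u - y))
   = (1 - l * (a + b)) *: u + ((l * a) *: x + (l * b) *: y).
  rewrite scalerBl scale1r -addrA; congr (u + _).
  rewrite !scalerBr !scalerDr !scalerN !scalerA addrACA -opprD opprB.
  by rewrite mulrDr scalerDl [RHS]addrC.
apply: convex_lincomb3 => //; [lra|exact: mulr_ge0|exact: mulr_ge0|lra].
Qed.

End Convexity.

(** * Local Lax-Friedrichs fluxes and their intermediate states *)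

Section LocalLaxFriedrichs.
Variables (R : realType) (V : lmodType R) (F : V -> V) (rho : V -> R).
Local Notation I := (intermediate F rho).
Local Notation a := (llf_speed rho).
Implicit Types (v w : V).

Lemma llf_speed_ge v w : rho v <= a v w /\ rho w <= a v w.
Proof. by rewrite /llf_speed !le_max !lexx orbT. Qed.

(** The weights are written t and 1 - t, with t = 1/2, to match [is_convex]. *)
Lemma intermediate_split v w :
  I v w = 2^-1 *: (v + (a v w)^-1 *: F v)
        + (1 - 2^-1) *: (w + (- (a v w)^-1) *: F w).
Proof.
have -> : 1 - 2^-1 = 2^-1 :> R by field.
by rewrite /intermediate !scalerDr !scalerN !scalerA mulrN scaleNr invfM addrACA.
Qed.

Let speed_intermediate v w : 0 < a v w -> a v w *: I v w =
  ((a v w / 2) *: v + (a v w / 2) *: w) + (2^-1 *: F v - 2^-1 *: F w).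
Proof.
move=> a0; rewrite /intermediate !scalerDr !scalerN !scalerA.
by rewrite invfM mulrCA divff ?mulr1// gt_eqF.
Qed.

Let double_half (k : R) (z : V) : k *: z = (k / 2) *: z + (k / 2) *: z.
Proof. by rewrite -scalerDl -splitr. Qed.

(** The interface is seen from the cell on its left; [llf_right] is the mirror image, seen from the
    cell on its right. *)
Lemma llf_left v w : 0 < a v w ->
  llf F rho v w = F v + a v w *: (v - I v w).
Proof.
move=> a0; rewrite scalerBr [a v w *: v]double_half.
rewrite -[F v]scale1r [1 *: F v]double_half mul1r speed_intermediate//.
rewrite /llf scalerDr scalerBr opprB.
(* Once the halved terms are abstracted, an identity in an abelian group remains. *)
move: (_ *: v) (_ *: w) (_ *: F v) (_ *: F w) => p q X Y.
rewrite opprD [p + p + _]addrA addrKA opprB.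
by rewrite [p - q + (Y - X)]addrC [RHS]addrA [X + X + _]addrACA subrr addr0.
Qed.

Lemma llf_right v w : 0 < a v w ->
  llf F rho v w = F w - a v w *: (w - I v w).
Proof.
move=> a0; rewrite scalerBr [a v w *: w]double_half.
rewrite -[F w]scale1r [1 *: F w]double_half mul1r speed_intermediate//.
rewrite /llf scalerDr scalerBr opprB.
move: (_ *: v) (_ *: w) (_ *: F v) (_ *: F w) => p q X Y.
rewrite opprB [p + q + _ - _]addrAC addrKA.
by rewrite [p - q + (X - Y)]addrC [RHS]addrA [Y + Y + _]addrACA subrr addr0 [Y + X]addrC.
Qed.

Lemma convex_llf_update (G : set V) (l : R) v u w : is_convex G ->
  0 < a v u -> 0 < a u w -> 0 <= l -> l * (a v u + a u w) <= 1 ->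
  G u -> G (I v u) -> G (I u w) ->
  G (u - l *: (llf F rho u w - llf F rho v u)).
Proof.
move=> cG avu auw l0 lle Gu Gvu Guw.
rewrite llf_left// llf_right//; apply: convex_flux_update => //.
- exact: ltW.
- exact: ltW.
- by rewrite [_ + a v u]addrC.
Qed.

End LocalLaxFriedrichs.

(** * Updated averages and low-order point values in a convex set *)

Section Scheme.
Variables (R : realType) (V : lmodType R) (F : V -> V) (rho : V -> R).
Variables (N g : nat) (xh : int -> R) (G : set V).
Hypothesis convG : is_convex G.
Implicit Types (U W : dofs V) (i : int).
Local Notation alpha := (alpha_avg rho).
Local Notation ut := (Utilde F rho).
Local Notation FL := (flux_L F rho).

(* The correction [flux - FL] of the LLF flux is absorbed by the states [x], [y]
   of [convex_flux_update]. *)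
Lemma avg_update_in dt U (flux : int -> V) i :
  0 < dt -> 0 < dx xh i -> 0 < alpha U (i - 1) -> 0 < alpha U i ->
  dt <= dx xh i / (alpha U (i - 1) + alpha U i) ->
  G (avg U i) ->
  G (ut U (i - 1) + (alpha U (i - 1))^-1 *: (flux (i - 1) - FL U (i - 1))) ->
  G (ut U i - (alpha U i)^-1 *: (flux i - FL U i)) ->
  G (avg_update xh dt U flux i).
Proof.
move=> dt0 dx0 am ap cfl_i Gu Gm Gp; rewrite /avg_update.
have -> : flux i = F (avg U i) + alpha U i *:
    (avg U i - (ut U i - (alpha U i)^-1 *: (flux i - FL U i))).
  rewrite opprB addrA [avg U i + _]addrC -addrA scalerDr scalerA mulfV ?gt_eqF//.
  by rewrite scale1r addrCA -llf_left// subrK.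
have -> : flux (i - 1) = F (avg U i) - alpha U (i - 1) *: (avg U i
    - (ut U (i - 1) + (alpha U (i - 1))^-1 *: (flux (i - 1) - FL U (i - 1)))).
  (* The quantities at interface [i - 1] involve the cells [i - 1] and [i - 1 + 1]; cell [i] has to
     appear in that form as the right neighbour. *)
  have -> : avg U i = avg U (i - 1 + 1) by rewrite subrK.
  rewrite opprD addrA scalerBr scalerA mulfV ?gt_eqF// scale1r opprB addrCA.
  by rewrite -llf_right// subrK.
apply: convex_flux_update => //.
- by rewrite divr_ge0 ?ltW.
- exact: ltW.
- exact: ltW.
- rewrite mulrAC ler_pdivrMr// mul1r -ler_pdivlMr ?addr_gt0//.
  by rewrite [alpha U i + _]addrC.
Qed.

(** The low-order point value is a finite-volume update on the dual cell around the interface, of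
    width half of [dx xh i + dx xh (i + 1)]; hence the factor 2 in the time step bound. *)
Lemma pt_L_in dt U i :
  0 < dt -> 0 < dx xh i + dx xh (i + 1) ->
  0 < alpha_pt rho U i -> 0 < alpha_pt rho U (i + 1) ->
  dt <= (dx xh i + dx xh (i + 1))
        / (2 * (alpha_pt rho U i + alpha_pt rho U (i + 1))) ->
  G (pt U i) -> G (intermediate F rho (pt U (i - 1)) (pt U i)) ->
  G (intermediate F rho (pt U i) (pt U (i + 1))) ->
  G (pt_L F rho xh dt U i).
Proof.
rewrite /alpha_pt addrK => dt0 dx0 am ap cfl_i Gu Gm Gp.
apply: convex_llf_update => //.
  by rewrite divr_ge0 ?mulr_ge0 ?ltW.
rewrite mulrAC ler_pdivrMr// mul1r [2 * dt]mulrC -mulrA.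
by rewrite -ler_pdivlMr// mulr_gt0// addr_gt0.
Qed.

Hypothesis hx : forall i, 1 - g%:Z <= i <= N%:Z + g%:Z -> xh (i - 1) < xh i.

Lemma dx_gt0 i : 1 - g%:Z <= i <= N%:Z + g%:Z -> 0 < dx xh i.
Proof. by move=> ig; rewrite subr_gt0 hx. Qed.

End Scheme.

(** * Invariance under the SSP-RK3 time stepping *)

Lemma every_stage_and (R : realType) (V : lmodType R) (N : nat)
    (S : R -> dofs V -> dofs V) (P Q : R -> dofs V -> Prop)
    (bc : nat -> nat -> dofs V -> dofs V) (U0 : dofs V) (dt : nat -> R) :
  every_stage N S bc P dt U0 -> every_stage N S bc Q dt U0 ->
  every_stage N S bc (fun t W => P t W /\ Q t W) dt U0.
Proof.
by move=> PS QS n; have [P0 P1 P2] := PS n; have [Q0 Q1 Q2] := QS n; split.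
Qed.

(** The second and third stages average the data of level n with a forward-Euler step, with
    nonnegative weights of sum 1, so a convex set kept by the step is kept by the scheme. Only mesh
    values are carried along; ghost values are filled anew before each step. [P] gathers the
    conditions imposed on the stages. *)
Lemma solution_in_mesh (R : realType) (V : lmodType R) (N g : nat) (G : set V)
    (S : R -> dofs V -> dofs V) (P : R -> dofs V -> Prop)
    (bc : nat -> nat -> dofs V -> dofs V) (U0 : dofs V) (dt : nat -> R) :
  is_convex G ->
  (forall t W, 0 < t -> P t W -> dofs_in N g G W -> in_mesh N G (S t W)) ->
  (forall (n k : nat) W, in_mesh N G W -> ghosts_in N g G (bc n k W)) ->
  in_mesh N G U0 -> (forall n, 0 < dt n) -> every_stage N S bc P dt U0 ->
  forall n, in_mesh N G (solution N S bc dt U0 n).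
Proof.
move=> cG SG bcG G0 dt0 PS; elim=> //= n Gn.
have comb (a b : R) U W : 0 <= a -> 0 <= b -> a + b = 1 ->
    in_mesh N G U -> in_mesh N G W -> in_mesh N G (lincomb a U b W).
  move=> a0 b0 ab [Ua Up] [Wa Wp].
  by split=> i im; apply: convex_lincomb => //; auto.
have fill k W : in_mesh N G W -> dofs_in N g G (fill_ghosts N (bc n k) W).
  by move=> GW; apply: fill_ghosts_in => //; exact: bcG.
have [P0 P1 P2] := PS n.
have G1 : in_mesh N G (S (dt n) (stage0 N bc n (solution N S bc dt U0 n))).
  by apply: SG => //; exact: fill.
have G2 : in_mesh N G (S (dt n) (stage1 N S bc n (dt n) (solution N S bc dt U0 n))).
  by apply: SG => //; exact: fill.
have G3 : in_mesh N G (S (dt n) (stage2 N S bc n (dt n) (solution N S bc dt U0 n))).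
  apply: SG => //; apply: fill.
  by apply: (comb (3 / 4) (1 / 4)) => //; lra.
by apply: (comb (1 / 3) (2 / 3)) => //; lra.
Qed.

(** * Scalar conservation laws *)

Section ScalarScheme.
Variables (R : realType) (f : R -> R).
Local Notation rho := (scalar_radius f).
Local Notation I := (@intermediate R R^o f rho).
Local Notation speed := (@llf_speed R R^o rho).

Lemma scalar_G_convex (m M : R) : @is_convex R R^o (scalar_G m M).
Proof.
move=> u v t /andP[t0 t1] /andP[um uM] /andP[vm vM]; apply/andP.
by rewrite /GRing.scale /=; split; nra.
Qed.

Lemma flux_lipschitz (v w : R) : speeds_bounded f v w ->
  (forall u, Num.min v w <= u <= Num.max v w -> derivable f u 1) ->
  `|f v - f w| <= speed v w * `|v - w|.
Proof.
move=> sb df.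
(* Ordering the end points by min and max lets one application of the mean value theorem serve both
   orders, and the closed interval admits [v = w]. *)
have [c cvw fc] : exists2 c, c \in `[Num.min v w, Num.max v w] &
    f (Num.max v w) - f (Num.min v w)
    = derive1 f c * (Num.max v w - Num.min v w).
  apply: MVT_segment; first by rewrite ge_min le_max lexx.
    move=> x xvw; rewrite derive1E; apply: derivableP; apply: df.
    by move: xvw; rewrite in_itv /= => /andP[/ltW -> /ltW ->].
  by apply: derivable_within_continuous => x; rewrite in_itv /= => /df.
have {fc} : `|f v - f w| = `|derive1 f c| * `|v - w|.
  case: (leP v w) fc => _ fc; last by rewrite -normrM fc.
  by rewrite distrC [`|v - w|]distrC -normrM fc.
move=> ->; apply: ler_wpM2r => //; apply: sb.
by move: cvw; rewrite in_itv.
Qed.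

(** The intermediate state differs from the midpoint by (f v - f w) / (2 a), which the Lipschitz
    bound makes at most half of |v - w|. *)
Lemma scalar_intermediate_between (v w : R) :
  0 < speed v w -> speeds_bounded f v w ->
  (forall u, Num.min v w <= u <= Num.max v w -> derivable f u 1) ->
  Num.min v w <= I v w <= Num.max v w.
Proof.
move=> a0 sb df; have := flux_lipschitz sb df.
rewrite -ler_pdivrMl// -[(speed v w)^-1]gtr0_norm ?invr_gt0// -normrM.
rewrite /intermediate /GRing.scale /= invfM -mulrA.
move: (_ * (f v - f w)) => d dvw.
move: dvw; rewrite ler_norml => /andP[].
have [vw|vw] := leP v w.
  by rewrite distrC ger0_norm ?subr_ge0// => d1 d2; lra.
by rewrite gtr0_norm ?subr_gt0// => d1 d2; lra.
Qed.

Lemma scalar_intermediate_in (m M v w : R) :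
  0 < speed v w -> speeds_bounded f v w ->
  (forall u, scalar_G m M u -> derivable f u 1) ->
  scalar_G m M v -> scalar_G m M w ->
  Num.min v w <= I v w <= Num.max v w /\ scalar_G m M (I v w).
Proof.
move=> a0 sb df /andP[mv vM] /andP[mw wM].
have minvw : m <= Num.min v w by rewrite le_min mv.
have maxvw : Num.max v w <= M by rewrite ge_max vM.
have /andP[lo hi] : Num.min v w <= I v w <= Num.max v w.
  apply: scalar_intermediate_between => // u /andP[ulo uhi]; apply: df.
  by rewrite /scalar_G /= (le_trans minvw ulo) (le_trans uhi maxvw).
split; first by rewrite lo.
by rewrite /scalar_G /= (le_trans minvw lo) (le_trans hi maxvw).
Qed.

(** [l1], [h1] are the bounds of the cell left of the interface, which sees the shift - c / a, and
    [l2], [h2] those of the cell on the right, which sees + c / a. For each sign of [d] two of the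
    four bounds are imposed by the limiter, and the other two follow from the sign of [c]. *)
Lemma limited_correction_between (d a x l1 h1 l2 h2 : R) :
  0 < a -> l1 <= x <= h1 -> l2 <= x <= h2 ->
  let c := if 0 <= d
           then Num.min d (Num.min (a * (x - l1)) (a * (h2 - x)))
           else Num.max d (Num.max (a * (l2 - x)) (a * (x - h1))) in
  l1 <= x - a^-1 * c <= h1 /\ l2 <= x + a^-1 * c <= h2.
Proof.
move=> a0 /andP[l1x xh1] /andP[l2x xh2] c.
have [c1 c2 c3 c4] : [/\ c <= a * (x - l1), a * (x - h1) <= c,
    a * (l2 - x) <= c & c <= a * (h2 - x)].
  have p1 : 0 <= a * (x - l1) by rewrite pmulr_rge0// subr_ge0.
  have p2 : 0 <= a * (h2 - x) by rewrite pmulr_rge0// subr_ge0.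
  have p3 : a * (l2 - x) <= 0 by rewrite pmulr_rle0// subr_le0.
  have p4 : a * (x - h1) <= 0 by rewrite pmulr_rle0// subr_le0.
  rewrite /c; case: ifPn => [d0|]; [|rewrite -ltNge => /ltW d0]; split.
  - by rewrite !ge_min lexx orbT.
  - by rewrite !le_min; apply/and3P; split; lra.
  - by rewrite !le_min; apply/and3P; split; lra.
  - by rewrite !ge_min lexx !orbT.
  - by rewrite !ge_max; apply/and3P; split; lra.
  - by rewrite !le_max lexx !orbT.
  - by rewrite !le_max lexx orbT.
  - by rewrite !ge_max; apply/and3P; split; lra.
move: c1 c2 c3 c4; rewrite -!(ler_pdivrMl _ _ a0) -!(ler_pdivlMl _ _ a0).
by move: (_ * c) => y *; split; lra.
Qed.

(** Blending moves [uL] by theta |uH - uL|, and each quotient caps this length by the distance from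
    [uL] to one bound. Because of the absolute values both caps apply whatever the direction of the
    move. *)
Lemma limited_blend_between (uL uH lo hi : R) : lo <= uL <= hi ->
  let theta := if uH == uL then 1 else
    Num.min 1 (Num.min `|(uL - lo) / (uL - uH)| `|(hi - uL) / (uH - uL)|) in
  lo <= theta * uH + (1 - theta) * uL <= hi.
Proof.
move=> /andP[loL Lhi] /=; set theta := if _ then _ else _.
have -> : theta * uH + (1 - theta) * uL = uL + theta * (uH - uL) by ring.
rewrite /theta; case: eqVneq => [->|HL]; first by rewrite subrr mulr0 addr0 loL.
set m := Num.min _ _.
have m0 : 0 <= m by rewrite !le_min ler01 !normr_ge0.
have m1 : m * `|uH - uL| <= uL - lo.
  apply: (@le_trans _ _ (`|(uL - lo) / (uL - uH)| * `|uH - uL|)).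
    by apply: ler_wpM2r => //; rewrite !ge_min lexx !orbT.
  rewrite normf_div [`|uL - uH|]distrC divfK ?normr_eq0 ?subr_eq0//.
  by rewrite ger0_norm// subr_ge0.
have m2 : m * `|uH - uL| <= hi - uL.
  apply: (@le_trans _ _ (`|(hi - uL) / (uH - uL)| * `|uH - uL|)).
    by apply: ler_wpM2r => //; rewrite !ge_min lexx !orbT.
  rewrite normf_div divfK ?normr_eq0 ?subr_eq0//.
  by rewrite ger0_norm// subr_ge0.
have : `|m * (uH - uL)| = m * `|uH - uL| by rewrite normrM ger0_norm.
have := ler_norm (m * (uH - uL)); have := ler_norm (- (m * (uH - uL))).
by rewrite normrN; lra.
Qed.

(** * One limited step for a scalar law on the mesh *)

Variables (N g : nat) (xh : int -> R) (m0 M0 : R).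
Variables (Rop : dofs R^o -> int -> R^o) (range_avg range_pt : limiting_range).
Hypothesis hg : (2 <= g)%N.
Hypothesis hx : forall i : int, 1 - g%:Z <= i <= N%:Z + g%:Z -> xh (i - 1) < xh i.
Hypothesis df : forall u : R, scalar_G m0 M0 u -> derivable f u 1.
Local Notation G := (scalar_G m0 M0 : set R^o).
Local Notation ut := (@Utilde R R^o f rho).
Local Notation lo := (umin N g f range_avg).
Local Notation hi := (umax N g f range_avg).

Variables (dt : R) (U : dofs R^o).
Hypothesis dt0 : 0 < dt.
Hypothesis GU : dofs_in N g G U.
Hypothesis vp : viscosity_pairs N (@viscosity_positive R R^o rho) U.
Hypothesis sb : viscosity_pairs N (speeds_bounded f) U.
Hypothesis cfl_U : @cfl R R^o rho xh N dt U.

(** This range of interfaces reads the averages from -1 to N + 2, which is where two ghost layers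
    are required. *)
Lemma scalar_Utilde_in (i : int) : -1 <= i <= N%:Z + 1 ->
  Num.min (avg U i) (avg U (i + 1)) <= ut U i
    <= Num.max (avg U i) (avg U (i + 1)) /\ G (ut U i).
Proof.
move=> iN; apply: scalar_intermediate_in => //.
- exact: vp.1.
- exact: sb.1.
- by apply: GU.1; lia.
- by apply: GU.1; lia.
Qed.

Lemma avg_bound_set_in (i : int) : 0 <= i <= N%:Z + 1 ->
  forall x, x \in avg_bound_set N g f range_avg U i -> G x.
Proof.
move=> iN x; rewrite /avg_bound_set; case: range_avg.
  exact: all_dofs_in GU _.
rewrite !inE => /or4P[/eqP->|/eqP->|/eqP->|/orP[]/eqP->].
- by apply: GU.1; lia.
- by apply: (scalar_Utilde_in _).2; lia.
- by apply: (scalar_Utilde_in _).2; lia.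
- by apply: GU.1; lia.
- by apply: GU.1; lia.
Qed.

Lemma avg_bound_set_neq0 (i : int) : avg_bound_set N g f range_avg U i != [::].
Proof. by rewrite /avg_bound_set; case: range_avg => //; exact: all_dofs_neq0. Qed.

Lemma umin_in (i : int) : 0 <= i <= N%:Z + 1 -> G (lo U i).
Proof.
by move=> iN; apply: min_seq_ind; [exact: avg_bound_set_neq0|exact: avg_bound_set_in].
Qed.

Lemma umax_in (i : int) : 0 <= i <= N%:Z + 1 -> G (hi U i).
Proof.
by move=> iN; apply: max_seq_ind; [exact: avg_bound_set_neq0|exact: avg_bound_set_in].
Qed.

(** Cell [i] has the interfaces [i - 1] and [i]. In the local case both intermediate states belong
    to the bound set; in the global case they do not, but lie between two averages that do. *)
Lemma Utilde_between (i j : int) : 0 <= i <= N%:Z + 1 -> j = i \/ j = i - 1 ->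
  lo U i <= ut U j <= hi U i.
Proof.
move=> iN ji; rewrite /umin /umax /avg_bound_set; case: range_avg.
  have jg : -1 <= j <= N%:Z + 1 by lia.
  have [/andP[jlo jhi] _] := scalar_Utilde_in jg.
  have mj : avg U j \in all_dofs N g U by apply: avg_in_all_dofs; lia.
  have mj1 : avg U (j + 1) \in all_dofs N g U by apply: avg_in_all_dofs; lia.
  apply/andP; split; [apply: le_trans jlo|apply: le_trans jhi _].
    by rewrite le_min !ge_min_seq.
  by rewrite ge_max !le_max_seq.
by apply/andP; split; [apply: ge_min_seq|apply: le_max_seq];
  case: ji => ->; rewrite !inE eqxx ?orbT.
Qed.

Lemma scalar_avg_in (i : int) : 1 <= i <= N%:Z ->
  G (@avg_update R R^o xh dt U (scalar_flux_lim N g f range_avg U) i).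
Proof.
move=> iN.
(* Both signs are needed: interface [j] is the right end of cell [j] and the left end of cell
   [j + 1]. *)
have lim (j : int) : 0 <= j <= N%:Z ->
    let d : R := (alpha_avg (V := R^o) rho U j)^-1 * scalar_dflux_lim N g f range_avg U j in
    G (ut U j - d) /\ G (ut U j + d).
  move=> jN d.
  have /andP[lo0 _] : G (lo U j) by apply: umin_in; lia.
  have /andP[lo1 _] : G (lo U (j + 1)) by apply: umin_in; lia.
  have /andP[_ hi0] : G (hi U j) by apply: umax_in; lia.
  have /andP[_ hi1] : G (hi U (j + 1)) by apply: umax_in; lia.
  have aj : 0 < alpha_avg (V := R^o) rho U j by apply: vp.1; lia.
  have b0 : lo U j <= ut U j <= hi U j by apply: Utilde_between; [lia|left].
  have b1 : lo U (j + 1) <= ut U j <= hi U (j + 1).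
    by apply: Utilde_between; [lia|right; rewrite addrK].
  have [/andP[l1 h1] /andP[l2 h2]] :
      lo U j <= ut U j - d <= hi U j /\ lo U (j + 1) <= ut U j + d <= hi U (j + 1).
    by rewrite /d /scalar_dflux_lim; exact: limited_correction_between.
  split; apply/andP; split.
  - exact: le_trans lo0 l1.
  - exact: le_trans h1 hi0.
  - exact: le_trans lo1 l2.
  - exact: le_trans h2 hi1.
have flux_d (j : int) : scalar_flux_lim N g f range_avg U j - @flux_L R R^o f rho U j
    = scalar_dflux_lim N g f range_avg U j by rewrite /scalar_flux_lim addrC addKr.
apply: (avg_update_in (F := f : R^o -> R^o) (rho := rho)) => //.
- exact: scalar_G_convex.
- by apply: (dx_gt0 hx); lia.
- by apply: vp.1; lia.
- by apply: vp.1; lia.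
- exact: cfl_U.1.
- by apply: GU.1; lia.
- by rewrite flux_d; apply: (lim _ _).2; lia.
- by rewrite flux_d; apply: (lim _ _).1; lia.
Qed.

(** A general subinterval of [m0, M0] is allowed because the local limiter needs the low-order value
    between the extremes of three neighbouring point values. *)
Lemma pt_L_between (m M : R) (i : int) : 0 <= i <= N%:Z ->
  m0 <= m -> M <= M0 ->
  scalar_G m M (pt U (i - 1)) -> scalar_G m M (pt U i) ->
  scalar_G m M (pt U (i + 1)) ->
  scalar_G m M (@pt_L R R^o f rho xh dt U i).
Proof.
move=> iN m0m MM0 Gm Gi Gp.
have dfm u : scalar_G m M u -> derivable f u 1.
  move=> /andP[mu uM]; apply: df.
  by rewrite /scalar_G /= (le_trans m0m mu) (le_trans uM MM0).
apply: (pt_L_in (F := f : R^o -> R^o) (rho := rho) (G := scalar_G m M)) => //.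
- exact: scalar_G_convex.
- by apply: addr_gt0; apply: (dx_gt0 hx); lia.
- by apply: vp.2; lia.
- by apply: vp.2; lia.
- exact: cfl_U.2.
- apply: (scalar_intermediate_in _ _ dfm _ _).2 => //.
  + by apply: vp.2; lia.
  + by apply: sb.2; lia.
- apply: (scalar_intermediate_in _ _ dfm _ _).2 => //.
  (* [viscosity_pairs] lists point values as pairs (i - 1, i), so the pair (i, i + 1) is its
     instance at [i + 1]. *)
  + by rewrite -{1}(addrK 1 i); apply: vp.2; lia.
  + by rewrite -{1}(addrK 1 i); apply: sb.2; lia.
Qed.

Lemma scalar_pt_in (i : int) : 0 <= i <= N%:Z ->
  G (scalar_pt_new N g xh f Rop range_pt dt U i).
Proof.
move=> iN; rewrite /scalar_pt_new; set s := pt_bound_set N g range_pt U i.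
have sG x : x \in s -> G x.
  rewrite /s /pt_bound_set; case: range_pt; first exact: all_dofs_in GU _.
  by rewrite !inE => /or3P[]/eqP->; apply: GU.2; lia.
have s0 : s != [::].
  by rewrite /s /pt_bound_set; case: range_pt => //; exact: all_dofs_neq0.
have pt_s (j : int) : i - 1 <= j <= i + 1 -> pt U j \in s.
  move=> ij; rewrite /s /pt_bound_set; case: range_pt.
    by apply: pt_in_all_dofs; lia.
  have /or3P[] : [|| j == i - 1, j == i | j == i + 1] by lia.
  - by move=> /eqP->; rewrite !inE eqxx.
  - by move=> /eqP->; rewrite !inE eqxx orbT.
  - by move=> /eqP->; rewrite !inE eqxx !orbT.
have /andP[m0m _] : G (min_seq s) by exact: min_seq_ind.
have /andP[_ MM0] : G (max_seq s) by exact: max_seq_ind.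
have between (j : int) : i - 1 <= j <= i + 1 -> scalar_G (min_seq s) (max_seq s) (pt U j).
  by move=> ij; rewrite /scalar_G /= ge_min_seq ?le_max_seq ?pt_s.
have /limited_blend_between : scalar_G (min_seq s) (max_seq s)
    (@pt_L R R^o f rho xh dt U i).
  by apply: pt_L_between => //; apply: between; lia.
move=> /(_ (@pt_H R R^o Rop dt U i)) /andP[nlo nhi].
by rewrite /scalar_G /= (le_trans m0m nlo) (le_trans nhi MM0).
Qed.

Lemma scalar_step_in :
  in_mesh N G (scalar_step N g xh f Rop range_avg range_pt dt U).
Proof. by split=> i iN; [exact: scalar_avg_in|exact: scalar_pt_in]. Qed.

End ScalarScheme.

(** * Wave speeds of the Euler equations *)

Lemma normc_real {R : realType} (x : R) :
  Normc.normc (real_complex R x) = `|x|.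
Proof. by rewrite /Normc.normc /= expr0n addr0 sqrtr_sqr. Qed.

(** A supremum dominates the members of a set only if the set is bounded above. Eigenvalues are
    roots of the characteristic polynomial, and the sum of the moduli of its finitely many roots is
    a bound. *)
Lemma spectral_radius_ge_normc {R : realType} {n : nat} (A : 'M[R]_n) (z : R[i]) :
  eigenvalue (map_mx (real_complex R) A) z ->
  Normc.normc z <= spectral_radius A.
Proof.
move=> Az; apply: ub_le_sup; last by exists z.
have [r char_r] := closed_field_poly_normal (char_poly (map_mx (real_complex R) A)).
exists (\sum_(w <- r) Normc.normc w) => _ [w /= Aw <-].
have normc_ge0 (x : R[i]) : 0 <= Normc.normc x.
  by case: x => x y; exact: sqrtr_ge0.
have: w \in r.
  move: Aw; rewrite eigenvalue_root_char char_r (monicP (char_poly_monic _)).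
  by rewrite scale1r root_prod_XsubC.
move=> wr; rewrite (big_rem w)//= lerDl; exact: sumr_ge0.
Qed.

Lemma spectral_radius_ge_norm {R : realType} {n : nat} (A : 'M[R]_n) (u : 'rV[R]_n) (a : R) :
  u != 0 -> u *m A = a *: u -> `|a| <= spectral_radius A.
Proof.
move=> u0 uA; rewrite -normc_real; apply: spectral_radius_ge_normc.
apply/eigenvalueP; exists (map_mx (real_complex R) u).
  by rewrite -map_mxM uA map_mxZ.
by rewrite map_mx_eq0.
Qed.

Lemma differentiable_rV {R : numFieldType} {V : normedModType R} {n : nat}
    (f : V -> 'rV[R]_n) (x : V) :
  (forall j, differentiable (fun y => f y 0 j) x) -> differentiable f x.
Proof.
move=> df.
rewrite (_ : f = \sum_(j < n) (fun y => f y 0 j *: delta_mx 0 j)).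
  by apply: differentiable_sum => j; exact: differentiableZl.
by apply/funext => y; rewrite {1}[f y]row_sum_delta fct_sumE.
Qed.

Lemma is_derive_coord {R : realFieldType} {m n : nat} (A B : 'M[R]_(m, n)) i j :
  is_derive A B (fun M : 'M[R]_(m, n) => M i j : R) (B i j).
Proof.
apply: DeriveDef; first exact/diff_derivable/differentiable_coord.
have /matrixP/(_ i j) := derive_mx (@derivable_id R 'M[R]_(m, n) A B).
by rewrite derive_id mxE.
Qed.

Lemma is_derive_inv {R : numFieldType} {V : normedModType R} (f : V -> R) (x v : V) (df : R) :
  f x != 0 -> is_derive x v f df ->
  is_derive x v (fun y => (f y)^-1) (- (f x) ^- 2 *: df).
Proof.
move=> fx0 dfx; apply: DeriveDef; first exact: derivableV.
by rewrite deriveV// derive_val.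
Qed.

Lemma mkstateE {R : realType} (a b c : R) :
  (dens (mkstate a b c) = a) * (mom (mkstate a b c) = b) * (ener (mkstate a b c) = c).
Proof. by rewrite /dens /mom /ener !mxE. Qed.

Lemma state_eqP {R : realType} (u w : 'rV[R]_3) :
  dens u = dens w -> mom u = mom w -> ener u = ener w -> u = w.
Proof.
move=> e0 e1 e2; apply/rowP => -[[|[|[|//]]] lt3].
- by rewrite [Ordinal _](_ : _ = 0)//; exact: val_inj.
- by rewrite [Ordinal _](_ : _ = 1)//; exact: val_inj.
- by rewrite [Ordinal _](_ : _ = 2)//; exact: val_inj.
Qed.

Section EulerEigen.
Variables (R : realType) (gamma : R).
Local Notation F := (euler_flux gamma).
Implicit Types u r : 'rV[R]_3.

(** The components are written as sums and products of functions so that the rules of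
    differentiation apply; [@mom R * (fun u => (dens u)^-1)] is the velocity. *)
Lemma euler_flux_coord (j : 'I_3) :
  (fun u => F u 0 j) =
  [:: @mom R;
      @dens R * (@mom R * (fun u => (dens u)^-1)) ^+ 2 + pressure gamma;
      (@ener R + pressure gamma) * (@mom R * (fun u => (dens u)^-1))]`_j.
Proof. by apply/funext => u; rewrite /euler_flux mxE; case: j => -[|[|[|]]]. Qed.

Lemma pressureE : pressure gamma = (gamma - 1) *:
  (@ener R - 2^-1 *: ((@mom R) ^+ 2 * (fun u => (dens u)^-1))).
Proof. by apply/funext => w; rewrite /pressure invfM mulrCA. Qed.

(** [dv] and [dp] are the derivatives of velocity and pressure in the direction [r]; the components
    then follow from the product rule. *)
Lemma is_derive_flux u r : dens u != 0 ->
  let v := mom u / dens u in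
  let dv := (mom r - v * dens r) / dens u in
  let dp := (gamma - 1) * (ener r - v * mom r + v ^+ 2 / 2 * dens r) in
  let dF := mkstate (mom r)
    (v ^+ 2 * dens r + 2 * dens u * v * dv + dp)
    ((ener r + dp) * v + (ener u + pressure gamma u) * dv) in
  forall j, is_derive u r (fun w => F w 0 j) (dF 0 j).
Proof.
move=> u0 v dv dp dF j.
have dd : is_derive u r (@dens R) (dens r) := is_derive_coord u r 0 0.
have dm : is_derive u r (@mom R) (mom r) := is_derive_coord u r 0 1.
have de : is_derive u r (@ener R) (ener r) := is_derive_coord u r 0 2.
have di := is_derive_inv u0 dd.
have dpr : is_derive u r (pressure gamma) dp.
  rewrite pressureE; apply: is_derive_eq.
  by rewrite /dp /v /GRing.scale /= !fctE; field.
rewrite euler_flux_coord /dF mxE.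
by case: j => -[|[|[|//]]] /= lt3; apply: is_derive_eq;
  rewrite /dv /v /= /GRing.scale /= ?fctE; field.
Qed.

(** For a differentiable flux, the Jacobian applied to [r] is the derivative in the direction [r],
    so no matrix entries have to be written out. *)
Lemma jacobian_euler_flux u r : dens u != 0 ->
  let v := mom u / dens u in
  let dv := (mom r - v * dens r) / dens u in
  let dp := (gamma - 1) * (ener r - v * mom r + v ^+ 2 / 2 * dens r) in
  r *m jacobian F u = mkstate (mom r)
    (v ^+ 2 * dens r + 2 * dens u * v * dv + dp)
    ((ener r + dp) * v + (ener u + pressure gamma u) * dv).
Proof.
move=> u0 v dv dp.
have dF := is_derive_flux r u0.
rewrite -deriveEjacobian; last first.
  apply: differentiable_rV => j; rewrite euler_flux_coord.
  have di : differentiable (fun w : 'rV[R]_3 => (dens w)^-1) u.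
    by apply: differentiableV => //; exact: differentiable_coord.
  have dd : differentiable (@dens R) u := differentiable_coord u 0 0.
  have dm : differentiable (@mom R) u := differentiable_coord u 0 1.
  have de : differentiable (@ener R) u := differentiable_coord u 0 2.
  have dP : differentiable (pressure gamma) u.
    rewrite pressureE; apply: differentiableZ; apply: differentiableB => //.
    apply: differentiableZ; apply: differentiableM => //.
    exact: differentiableX.
  have dq : differentiable (@mom R * (fun w => (dens w)^-1)) u.
    exact: differentiableM.
  case: j => -[|[|[|//]]] lt3 /=; first exact: dm.
    apply: differentiableD => //; apply: differentiableM => //.
    exact: differentiableX.
  by apply: differentiableM => //; exact: differentiableD.
rewrite derive_mx; last first.
  by apply/derivable_mxP => i j; rewrite ord1; have [] := dF j.
by apply/rowP => j; rewrite mxE (@derive_val _ _ _ _ _ _ _ (dF j)).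
Qed.

(** With [c] the speed of sound, v + c and v - c are eigenvalues; the sign of the velocity tells
    which of them has modulus |v| + c. *)
Lemma euler_radius_ge u : 1 < gamma -> euler_G gamma u ->
  `|mom u / dens u| + Num.sqrt (gamma * pressure gamma u / dens u)
    <= euler_radius gamma u.
Proof.
move=> g1 [u0 p0]; set v := mom u / dens u; set c := Num.sqrt _.
have c2 : c ^+ 2 = gamma * pressure gamma u / dens u.
  have g0 : 0 <= gamma := ltW (lt_trans ltr01 g1).
  by rewrite sqr_sqrtr//; apply: divr_ge0; [apply: mulr_ge0 => //|]; exact: ltW.
have un0 : dens u != 0 by rewrite gt_eqF.
have g1n0 : gamma - 1 != 0 by rewrite subr_eq0 gt_eqF.
have eig s : s ^+ 2 = c ^+ 2 -> `|v + s| <= euler_radius gamma u.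
  rewrite c2 => s2.
  (* (1, v + s, h + v s), with h the specific enthalpy, is the acoustic
     eigenvector for the eigenvalue v + s, s = c or s = - c. *)
  pose h := (ener u + pressure gamma u) / dens u.
  apply: (@spectral_radius_ge_norm _ _ _ (mkstate 1 (v + s) (h + v * s))).
    by apply/eqP => /rowP/(_ 0); rewrite !mxE; move=> /eqP; rewrite oner_eq0.
  have hs : (gamma - 1) * (h - v ^+ 2 / 2) = s ^+ 2.
    by rewrite s2 /h /v /pressure; field.
  rewrite jacobian_euler_flux// !mkstateE -/v.
  (* Along the eigenvector the derivative of the pressure is s^2. *)
  have -> : (gamma - 1) * (h + v * s - v * (v + s) + v ^+ 2 / 2 * 1) = s ^+ 2.
    by rewrite -hs; field.
  apply: state_eqP; rewrite /dens /mom /ener !mxE /= -/(dens u).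
  - by rewrite mulr1.
  - by field.
  - by rewrite -/(ener u) /h; field.
have c0 : 0 <= c := sqrtr_ge0 _.
have [v0|/ltW v0] := leP 0 v.
  by have := eig c erefl; rewrite !ger0_norm ?addr_ge0.
have := eig (- c); rewrite sqrrN !ler0_norm; [|lra|lra].
by rewrite opprB [c - v]addrC; apply.
Qed.
End EulerEigen.

(** * The limited Euler step *)

Section EulerScheme.
Variables (R : realType) (gamma : R).
Hypothesis gamma1 : 1 < gamma.
Local Notation F := (euler_flux gamma).
Local Notation p := (pressure gamma).
Local Notation G := (euler_G gamma).
Local Notation rho := (euler_radius gamma).
Implicit Types (u w T D : 'rV[R]_3).

Let g1 : 0 < gamma - 1. Proof. by rewrite subr_gt0. Qed.
Let g0 : 0 < gamma. Proof. exact: lt_trans ltr01 gamma1. Qed.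

Lemma dens_lincomb (a b : R) u w : dens (a *: u + b *: w) = a * dens u + b * dens w.
Proof. by rewrite /dens !mxE. Qed.

Lemma mom_lincomb (a b : R) u w : mom (a *: u + b *: w) = a * mom u + b * mom w.
Proof. by rewrite /mom !mxE. Qed.

Lemma ener_lincomb (a b : R) u w : ener (a *: u + b *: w) = a * ener u + b * ener w.
Proof. by rewrite /ener !mxE. Qed.

(** Energy is linear, so the gap comes from the kinetic energy m^2 / (2 rho) alone, which is convex
    for positive density; its Jensen gap is an explicit square over positive densities. *)
Lemma pressure_concave u w (t : R) : 0 <= t <= 1 -> 0 < dens u -> 0 < dens w ->
  t * p u + (1 - t) * p w <= p (t *: u + (1 - t) *: w).
Proof.
move=> /andP[t0 t1] u0 w0.
have d0 : 0 < dens (t *: u + (1 - t) *: w) by rewrite dens_lincomb; nra.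
rewrite -subr_ge0.
have -> : p (t *: u + (1 - t) *: w) - (t * p u + (1 - t) * p w) =
    (gamma - 1) * (t * (1 - t) * (mom u * dens w - mom w * dens u) ^+ 2
      / (2 * (dens u * dens w * dens (t *: u + (1 - t) *: w)))).
  have := d0; rewrite /pressure mom_lincomb ener_lincomb dens_lincomb => d1.
  by field; rewrite !gt_eqF.
apply: mulr_ge0; first exact: ltW.
apply: divr_ge0; last by rewrite ltW// !mulr_gt0.
by rewrite mulr_ge0 ?sqr_ge0// mulr_ge0// subr_ge0.
Qed.

Lemma euler_G_convex : is_convex G.
Proof.
move=> u w t /andP[t0 t1] [u0 pu] [w0 pw]; split.
  by rewrite dens_lincomb; nra.
apply: lt_le_trans (@pressure_concave u w t _ u0 w0); first by nra.
by rewrite t0.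
Qed.

(** The shift multiplies the density by k = 1 + s v, and |s| (|v| + c) <= 1 gives |s| c <= k. The
    pressure becomes k p - (gamma - 1) s^2 p^2 / (2 rho k), which c^2 = gamma p / rho turns into a
    comparison of k with |s| c. *)
Lemma flux_shift_in u (s a : R) : G u -> rho u <= a -> `|s| * a <= 1 ->
  G (u + s *: F u).
Proof.
move=> Gu ua sa; have [u0 pu] := Gu.
set v := mom u / dens u; set c := Num.sqrt (gamma * p u / dens u).
have vca : `|v| + c <= a by apply: le_trans ua; exact: euler_radius_ge.
have gp : 0 < gamma * p u / dens u.
  by rewrite divr_gt0// mulr_gt0.
have c0 : 0 < c by rewrite sqrtr_gt0.
have c2 : c ^+ 2 = gamma * p u / dens u by rewrite sqr_sqrtr// ltW.
set k := 1 + s * v.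
have svc : `|s| * `|v| + `|s| * c <= 1.
  by apply: le_trans sa; rewrite -mulrDr ler_wpM2l.
have svk : 1 - `|s| * `|v| <= k.
  by rewrite -normrM /k; have := ler_norm (- (s * v)); rewrite normrN; lra.
have kc : `|s| * c <= k by lra.
have k0 : 0 < k.
  have [s0|s0] := eqVneq s 0; first by rewrite /k s0 mul0r addr0.
  by apply: lt_le_trans kc; rewrite mulr_gt0// normr_gt0.
have dk : dens (u + s *: F u) = dens u * k.
  rewrite -[u]scale1r dens_lincomb scale1r mul1r /euler_flux mkstateE /k /v.
  by field; rewrite gt_eqF.
split; first by rewrite dk mulr_gt0.
have -> : p (u + s *: F u) =
    p u / (2 * gamma * k) * (2 * gamma * k ^+ 2 - (gamma - 1) * (`|s| * c) ^+ 2).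
  rewrite exprMn real_normK ?num_real// c2.
  have -> : p (u + s *: F u) = (gamma - 1) * (ener (u + s *: F u)
      - mom (u + s *: F u) ^+ 2 / (2 * (dens u * k))) by rewrite -dk.
  rewrite -[u in ener (u + _)]scale1r -[u in mom (u + _)]scale1r.
  rewrite mom_lincomb ener_lincomb /euler_flux !mkstateE.
  have pe : ener u = p u / (gamma - 1) + dens u * v ^+ 2 / 2.
    by rewrite /pressure /v; field; rewrite !gt_eqF.
  have me : mom u = dens u * v by rewrite /v mulrC divfK// gt_eqF.
  rewrite pe me -/v.
  have k0' : 1 + s * v != 0 by rewrite gt_eqF.
  have gam0 : gamma != 0 by rewrite gt_eqF.
  by rewrite /k; field; rewrite k0' gam0 !gt_eqF.
apply: mulr_gt0.
  by rewrite divr_gt0// !mulr_gt0.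
have sc0 : 0 <= `|s| * c by rewrite mulr_ge0// ltW.
have sck : (`|s| * c) ^+ 2 <= k ^+ 2 by rewrite ler_sqr ?nnegrE// ltW.
(* The splitting 2 gamma = (gamma + 1) + (gamma - 1) leaves a positive term and a multiple of k^2 -
   (s c)^2. *)
have : 0 < (gamma + 1) * k ^+ 2 by rewrite mulr_gt0 ?addr_gt0 ?exprn_gt0.
have : 0 <= (gamma - 1) * (k ^+ 2 - (`|s| * c) ^+ 2).
  by rewrite mulr_ge0 ?subr_ge0// ltW.
by lra.
Qed.

Lemma euler_intermediate_in v w :
  0 < llf_speed rho v w -> G v -> G w -> G (intermediate F rho v w).
Proof.
move=> a0 Gv Gw; rewrite intermediate_split.
have [va wa] := llf_speed_ge rho v w.
apply: euler_G_convex; first by rewrite invr_ge0 ler0n invf_le1 ?ler1n.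
- apply: flux_shift_in Gv va _.
  by rewrite gtr0_norm ?invr_gt0// mulVf// gt_eqF.
- apply: flux_shift_in Gw wa _.
  by rewrite normrN gtr0_norm ?invr_gt0// mulVf// gt_eqF.
Qed.

(** Clearing the density makes the bound quadratic in the state, hence a quadratic in the blending
    coefficient along a segment. *)
Lemma le_pressure u (e : R) : 0 < dens u ->
  (e <= p u) =
  (0 <= dens u * ener u - 2^-1 * mom u ^+ 2 - e / (gamma - 1) * dens u).
Proof.
move=> u0.
have -> : dens u * ener u - 2^-1 * mom u ^+ 2 - e / (gamma - 1) * dens u
    = dens u / (gamma - 1) * (p u - e).
  by rewrite /pressure; field; rewrite !gt_eqF.
by rewrite pmulr_rge0 ?subr_ge0// divr_gt0.
Qed.

Lemma limited_correction_in T D (a er ep s : R) :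
  0 < a -> 0 < er -> 0 < ep -> er <= dens T -> ep <= p T ->
  `|dens D| <= a * (dens T - er) -> s ^+ 2 = 1 ->
  let e := ep / (gamma - 1) in
  let A := 2^-1 * mom D ^+ 2 - dens D * ener D in
  let B := a * (dens D * ener T + dens T * ener D - mom D * mom T
                - e * dens D) in
  let C := a ^+ 2 * (dens T * ener T - 2^-1 * mom T ^+ 2 - e * dens T) in
  let den := Num.max 0 A + `|B| in
  let theta := if den == 0 then 1 else Num.min 1 (C / den) in
  G (T + (s * a^-1) *: (theta *: D)).
Proof.
move=> a0 er0 ep0 erT epT dD s2 e A B C den theta.
have T0 : 0 < dens T := lt_le_trans er0 erT.
have C0 : 0 <= C by rewrite mulr_ge0 ?sqr_ge0// -le_pressure.
have max0 : 0 <= Num.max 0 A by rewrite le_max lexx.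
have den0 : 0 <= den by rewrite addr_ge0.
have [th0 th1 thC] : [/\ 0 <= theta, theta <= 1 & theta * den <= C].
  (* For a zero denominator the default theta = 1 is harmless, since theta times the denominator is
     still 0 <= C. *)
  rewrite /theta; case: eqVneq => [->|den1]; first by rewrite mulr0.
  have denp : 0 < den by rewrite lt_def den1.
  split; first by rewrite le_min ler01 divr_ge0.
    by rewrite ge_min lexx.
  by rewrite -ler_pdivlMr// ge_min lexx orbT.
have s1 : `|s| = 1.
  by apply/eqP; rewrite -(@eqrXn2 _ 2)// ?expr1n ?real_normK ?num_real// s2.
set W := T + _.
have WE : W = 1 *: T + (s * a^-1 * theta) *: D by rewrite /W scalerA scale1r.
have aW : a * (dens W - er) >= 0.
  rewrite WE dens_lincomb mul1r.
  have -> : a * (dens T + s * a^-1 * theta * dens D - er)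
      = a * (dens T - er) + s * theta * dens D by field; rewrite gt_eqF.
  have : `|s * theta * dens D| <= a * (dens T - er).
    rewrite !normrM s1 mul1r (ger0_norm th0); apply: le_trans dD.
    by rewrite ler_piMl.
  by rewrite ler_norml => /andP[+ _]; lra.
have W0 : 0 < dens W.
  by apply: lt_le_trans er0 _; rewrite -subr_ge0 -(pmulr_rge0 _ a0).
split=> //; apply: lt_le_trans ep0 _; rewrite le_pressure// -/e.
rewrite -(@pmulr_rge0 _ (a ^+ 2)) ?exprn_gt0//.
have -> : a ^+ 2 * (dens W * ener W - 2^-1 * mom W ^+ 2 - e * dens W)
    = C + s * theta * B - (s ^+ 2) * theta ^+ 2 * A.
  rewrite WE dens_lincomb mom_lincomb ener_lincomb /C /B /A.
  by field; rewrite gt_eqF.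
have sB : `|s * theta * B| = theta * `|B| by rewrite !normrM s1 mul1r ger0_norm.
have := ler_norm (- (s * theta * B)); rewrite normrN sB s2 mul1r.
(* As 0 <= theta <= 1, the quadratic term costs at most theta max(0, A), and the sum is at least C -
   theta (max(0, A) + |B|). *)
have : theta ^+ 2 * A <= theta * Num.max 0 A.
  apply: (@le_trans _ _ (theta ^+ 2 * Num.max 0 A)).
    by rewrite ler_wpM2l ?sqr_ge0// le_max lexx orbT.
  by rewrite ler_wpM2r// expr2 ler_piMl.
by move: thC; rewrite /den mulrDr; lra.
Qed.

(** The first blend lifts the density to at least [er], so concavity of the pressure holds on the
    segment from [Us] to [UL]; when the second limiter acts, [th2] is the point where the chord of
    the pressure equals [ep]. *)
Lemma limited_blend_in UL UH (er ep : R) :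
  0 < er -> er <= dens UL -> 0 < ep -> ep <= p UL ->
  let th1 := if dens UH < er then (dens UL - er) / (dens UL - dens UH)
             else 1 in
  let Us := mkstate (th1 * dens UH + (1 - th1) * dens UL) (mom UH) (ener UH) in
  let th2 := if p Us < ep then (p UL - ep) / (p UL - p Us) else 1 in
  G (th2 *: Us + (1 - th2) *: UL).
Proof.
move=> er0 erL ep0 epL th1 Us th2.
have L0 : 0 < dens UL := lt_le_trans er0 erL.
have s0 : 0 < dens Us.
  rewrite /Us mkstateE; apply: lt_le_trans er0 _.
  rewrite /th1; case: ltP => [Her|]; last by rewrite mul1r subrr mul0r addr0.
  have HL : 0 < dens UL - dens UH by lra.
  set t := _ / _; have : t * (dens UL - dens UH) = dens UL - er.
    by rewrite /t divfK// gt_eqF.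
  lra.
rewrite /th2; case: ltP => [Us_ep|]; last first.
  rewrite scale1r subrr scale0r addr0 => epUs.
  by split=> //; exact: lt_le_trans epUs.
have HL : 0 < p UL - p Us by lra.
set t := _ / _; have tE : t * (p UL - p Us) = p UL - ep.
  by rewrite /t divfK// gt_eqF.
have t01 : 0 <= t <= 1.
  have ep_ge0 : 0 <= p UL - ep by rewrite subr_ge0.
  by apply/andP; split; [exact: divr_ge0 (ltW HL)|rewrite ler_pdivrMr//; lra].
have /andP[t0 t1] := t01.
split; first by rewrite dens_lincomb; nra.
apply: lt_le_trans (pressure_concave t01 s0 L0).
by apply: lt_le_trans ep0 _; lra.
Qed.
End EulerScheme.

(** * The Euler limiters on the mesh *)

Section EulerStep.
Variables (R : realType) (gamma : R).
Hypothesis gamma1 : 1 < gamma.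
Local Notation F := (euler_flux gamma).
Local Notation p := (pressure gamma).
Local Notation G := (euler_G gamma).
Local Notation rho := (euler_radius gamma).
Variables (N g : nat) (xh : int -> R).
Variable Rop : dofs 'rV[R]_3 -> int -> 'rV[R]_3.
Hypothesis hg : (2 <= g)%N.
Hypothesis hx : forall i : int, 1 - g%:Z <= i <= N%:Z + g%:Z -> xh (i - 1) < xh i.
Local Notation ut := (Utilde F rho).
Variables (dt : R) (U : dofs 'rV[R]_3).
Hypothesis dt0 : 0 < dt.
Hypothesis GU : dofs_in N g G U.
Hypothesis vp : viscosity_pairs N (viscosity_positive rho) U.
Hypothesis cfl_U : cfl rho xh N dt U.

Lemma euler_Utilde_in (i : int) : -1 <= i <= N%:Z + 1 -> G (ut U i).
Proof.
move=> iN; apply: euler_intermediate_in => //.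
- exact: vp.1.
- by apply: GU.1; lia.
- by apply: GU.1; lia.
Qed.

Lemma all_dofs_min_gt0 (h : 'rV[R]_3 -> R) : (forall u, G u -> 0 < h u) ->
  0 < min_seq [seq h u | u <- all_dofs N g U].
Proof.
move=> h0; apply: min_seq_gt0.
  by rewrite -size_eq0 size_map size_eq0 all_dofs_neq0.
by move=> _ /mapP[u /(all_dofs_in GU) Gu ->]; exact: h0.
Qed.

Lemma eps_dens_gt0 : 0 < eps_dens N g U.
Proof. by apply: all_dofs_min_gt0 => u []. Qed.

Lemma eps_pres_gt0 : 0 < eps_pres N g gamma U.
Proof. by apply: all_dofs_min_gt0 => u []. Qed.

Let tiny_gt0 : 0 < 10 ^- 13 :> R.
Proof. by rewrite invr_gt0 exprn_gt0. Qed.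

Lemma eps_dens_cell_gt0 (i : int) : 0 <= i <= N%:Z + 1 ->
  0 < eps_dens_cell N g gamma U i.
Proof.
move=> iN.
have [d0 _] : G (ut U (i - 1)) by apply: euler_Utilde_in; lia.
have [d1 _] : G (ut U i) by apply: euler_Utilde_in; lia.
apply: min_seq_gt0 => // x; rewrite !inE.
by move=> /or4P[]/eqP->; rewrite ?eps_dens_gt0.
Qed.

Lemma eps_pres_cell_gt0 (i : int) : 0 <= i <= N%:Z + 1 ->
  0 < eps_pres_cell N g gamma U i.
Proof.
move=> iN.
have [_ p0] : G (ut U (i - 1)) by apply: euler_Utilde_in; lia.
have [_ p1] : G (ut U i) by apply: euler_Utilde_in; lia.
apply: min_seq_gt0 => // x; rewrite !inE.
by move=> /or4P[]/eqP->; rewrite ?eps_pres_gt0.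
Qed.

Lemma eps_dens_bar_in (i : int) : 0 <= i <= N%:Z ->
  0 < eps_dens_bar N g gamma U i <= dens (ut U i).
Proof.
move=> iN; apply/andP; split.
  by rewrite lt_min !eps_dens_cell_gt0//; lia.
(* The intermediate state at [i] is among the candidates of cell [i], so the left cell alone gives
   the bound. *)
rewrite ge_min; apply/orP; left.
by apply: ge_min_seq; rewrite !inE eqxx !orbT.
Qed.

Lemma eps_pres_bar_in (i : int) : 0 <= i <= N%:Z ->
  0 < eps_pres_bar N g gamma U i <= p (ut U i).
Proof.
move=> iN; apply/andP; split.
  by rewrite lt_min !eps_pres_cell_gt0//; lia.
rewrite ge_min; apply/orP; left.
by apply: ge_min_seq; rewrite !inE eqxx !orbT.
Qed.

(** The limiter clamps to an interval symmetric about 0, which serves the cells on both sides of the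
    interface. *)
Lemma dflux_lim_dens_bound (i : int) : 0 <= i <= N%:Z ->
  `|dflux_lim_dens N g gamma U i|
  <= alpha_avg rho U i * (dens (ut U i) - eps_dens_bar N g gamma U i).
Proof.
move=> iN; have a0 : 0 < alpha_avg rho U i by apply: vp.1; lia.
have /andP[_] := eps_dens_bar_in iN.
rewrite /dflux_lim_dens; move: (dens _ - dens _) (alpha_avg _ _ _) a0 => d a a0.
move: (dens _) (eps_dens_bar _ _ _ _ _) => T e eT.
have aT : 0 <= a * (T - e) by rewrite mulr_ge0 ?subr_ge0// ltW.
case: ifPn => [d0|]; last rewrite -ltNge => /ltW d0.
  by rewrite ger0_norm ?le_min ?d0// ge_min lexx orbT.
rewrite -[e - T]opprB mulrN ler0_norm; last by rewrite ge_max d0 oppr_le0.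
by rewrite lerNl le_max lexx orbT.
Qed.

(** s = 1 is the shift seen by the cell right of the interface, s = -1 the one seen by the cell on
    the left. *)
Lemma limited_flux_in (i : int) (s : R) : 0 <= i <= N%:Z -> s ^+ 2 = 1 ->
  G (ut U i + (s * (alpha_avg rho U i)^-1)
       *: (euler_flux_lim N g gamma U i - flux_L F rho U i)).
Proof.
move=> iN s2; have a0 : 0 < alpha_avg rho U i by apply: vp.1; lia.
have /andP[er0 erT] := eps_dens_bar_in iN.
have /andP[ep0 epT] := eps_pres_bar_in iN.
rewrite /euler_flux_lim [_ + _ *: _ - _]addrC addKr.
apply: (limited_correction_in gamma1 a0 er0 ep0) => //.
apply: le_trans (dflux_lim_dens_bound iN).
by rewrite /flux_star /dens !mxE /= addrC addKr.
Qed.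

Lemma euler_avg_in (i : int) : 1 <= i <= N%:Z ->
  G (avg_update xh dt U (euler_flux_lim N g gamma U) i).
Proof.
move=> iN; apply: (avg_update_in (F := F) (rho := rho)) => //.
- exact: euler_G_convex.
- by apply: (dx_gt0 hx); lia.
- by apply: vp.1; lia.
- by apply: vp.1; lia.
- exact: cfl_U.1.
- by apply: GU.1; lia.
- by rewrite -[_^-1]mul1r; apply: limited_flux_in; [lia|rewrite expr1n].
- by rewrite -scaleNr -mulN1r; apply: limited_flux_in; [lia|rewrite sqrrN expr1n].
Qed.

Lemma euler_pt_L_in (i : int) : 0 <= i <= N%:Z -> G (pt_L F rho xh dt U i).
Proof.
move=> iN; apply: pt_L_in => //.
- exact: euler_G_convex.
- by apply: addr_gt0; apply: (dx_gt0 hx); lia.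
- by apply: vp.2; lia.
- by apply: vp.2; lia.
- exact: cfl_U.2.
- by apply: GU.2; lia.
- by apply: euler_intermediate_in => //; [apply: vp.2|apply: GU.2|apply: GU.2]; lia.
- apply: euler_intermediate_in => //; [|apply: GU.2; lia|apply: GU.2; lia].
  by rewrite -{1}(addrK 1 i); apply: vp.2; lia.
Qed.

Lemma euler_pt_in (i : int) : 0 <= i <= N%:Z ->
  G (euler_pt_new N g xh gamma Rop dt U i).
Proof.
move=> iN; have [L0 pL] := euler_pt_L_in iN.
apply: limited_blend_in => //.
- apply: min_seq_gt0 => // x; rewrite !inE.
  by move=> /or3P[]/eqP->; rewrite ?eps_dens_gt0.
- by apply: ge_min_seq; rewrite !inE eqxx !orbT.
- apply: min_seq_gt0 => // x; rewrite !inE.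
  by move=> /or3P[]/eqP->; rewrite ?eps_pres_gt0.
- by apply: ge_min_seq; rewrite !inE eqxx !orbT.
Qed.

Lemma euler_step_in : in_mesh N G (euler_step N g xh gamma Rop dt U).
Proof. by split=> i iN; [exact: euler_avg_in|exact: euler_pt_in]. Qed.

End EulerStep.

Theorem theoremC1 (R : realType) (N g : nat) (xh : int -> R)
    (hN : (0 < N)%N) (hg : (2 <= g)%N)
    (hx : forall i : int, 1 - g%:Z <= i <= N%:Z + g%:Z -> xh (i - 1) < xh i) :
                                    
  (forall (f u0 : R -> R) (m0 M0 : R)
      (range_avg range_pt : limiting_range)
      (Rop : dofs R^o -> int -> R^o)
      (bc : nat -> nat -> dofs R^o -> dofs R^o)
      (U0 : dofs R^o) (dt : nat -> R),
    let G := scalar_G m0 M0 in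
    let rho := scalar_radius f in
    let step := scalar_step N g xh f Rop range_avg range_pt in
    is_minimum [set u0 x | x in [set x | xh 0 <= x <= xh N%:Z]] m0 ->
    is_maximum [set u0 x | x in [set x | xh 0 <= x <= xh N%:Z]] M0 ->
    (forall u : R, G u -> derivable f u 1) ->
    has_stencil g Rop ->
    (forall (n k : nat) W, in_mesh N G W -> ghosts_in N g G (bc n k W)) ->
    in_mesh N G U0 ->
    (forall n, 0 < dt n) ->
    every_stage N step bc
      (fun _ => viscosity_pairs N (@viscosity_positive R R^o rho)) dt U0 ->
    every_stage N step bc
      (fun _ => viscosity_pairs N (speeds_bounded f)) dt U0 ->
    every_stage N step bc (@cfl R R^o rho xh N) dt U0 ->
    forall n : nat,
      (forall i : int, 1 <= i <= N%:Z ->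
         m0 <= avg (solution N step bc dt U0 n) i <= M0) /\
      (forall i : int, 0 <= i <= N%:Z ->
         m0 <= pt (solution N step bc dt U0 n) i <= M0))
  /\
                                        
  (forall (gamma : R)
      (Rop : dofs 'rV[R]_3 -> int -> 'rV[R]_3)
      (bc : nat -> nat -> dofs 'rV[R]_3 -> dofs 'rV[R]_3)
      (U0 : dofs 'rV[R]_3) (dt : nat -> R),
    let G := euler_G gamma in
    let rho := euler_radius gamma in
    let step := euler_step N g xh gamma Rop in
    1 < gamma ->
    has_stencil g Rop ->
    (forall (n k : nat) W, in_mesh N G W -> ghosts_in N g G (bc n k W)) ->
    in_mesh N G U0 ->
    (forall n, 0 < dt n) ->
    every_stage N step bc
      (fun _ => viscosity_pairs N (viscosity_positive rho)) dt U0 ->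
    every_stage N step bc (cfl rho xh N) dt U0 ->
    forall n : nat,
      (forall i : int, 1 <= i <= N%:Z ->
         let u := avg (solution N step bc dt U0 n) i in
         0 < dens u /\ 0 < pressure gamma u) /\
      (forall i : int, 0 <= i <= N%:Z ->
         let u := pt (solution N step bc dt U0 n) i in
         0 < dens u /\ 0 < pressure gamma u)).
Proof.
split=> [f u0 m0 M0 range_avg range_pt Rop bc U0 dt G rho step _ _ df _ bcG G0
    dt0 vp sb cfl_S n|gamma Rop bc U0 dt G rho step gamma1 _ bcG G0 dt0 vp cfl_S n].
  (* With the stage conditions joined into one predicate, only convexity and the invariance of a
     single step remain. *)
  have PS := every_stage_and vp (every_stage_and sb cfl_S).
  apply: solution_in_mesh bcG G0 dt0 PS n; first exact: scalar_G_convex.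
  by move=> t W t0 [? [? ?]] GW; exact: scalar_step_in.
have PS := every_stage_and vp cfl_S.
apply: solution_in_mesh bcG G0 dt0 PS n; first exact: euler_G_convex.
by move=> t W t0 [? ?] GW; exact: euler_step_in.
Qed.
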